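(* Consider the linear programming problem $$\text{minimize } c^T x \quad \text{subject to } Ax = b,\ x \ge 0, \qquad (\mathrm{LP})$$ where $A\in\mathbb{R}^{m\times n}$ has full rank $m$, $m<n$, $b\in\mathbb{R}^m$, $c\in\mathbb{R}^n$, and suppose that (LP) has an optimal solution. Let $(x^k)_{k\ge 1}$, $(\mu^k)_{k\ge 1}$, $(\lambda^k)_{k\ge 1}$ be sequences generated by the Idiot penalty algorithm (described in the context), where at least one update of $\lambda$ is performed in every $W$ consecutive iterations for some constant $W$. Suppose that, for each $k=1,2,\ldots$, $x^k$ is an exact global minimizer over $\{x\in\mathbb{R}^n : x\ge 0\}$ of $$h^k(x) = c^T x + (\lambda^k)^T r(x) + \frac{1}{2\mu^k}\, r(x)^T r(x), \qquad r(x) = Ax-b,$$ and that $\mu^k\to 0$ as $k\to\infty$. Then every limit point of the sequence $(x^k)$ is a solution (i.e. an optimal solution) of (LP).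
   Context: Inequalities between vectors are componentwise. A limit point of a sequence is the limit of some infinite subsequence. The Idiot penalty algorithm for (LP), with $r(x)=Ax-b$, is as follows. Choose $\mu^0>0$, set $\lambda^0 = 0\in\mathbb{R}^m$, $\mu^1=\mu^0$, $\lambda^1=\lambda^0$, and fix a factor $\omega>1$. For $k=1,2,3,\ldots$: 1. Let $x^k\in\arg\min_{x\ge 0} h^k(x)$, where $h^k(x) = c^T x + (\lambda^k)^T r(x) + \frac{1}{2\mu^k} r(x)^T r(x)$. 2. Perform exactly one of the following two updates (which of the two is performed at each iteration is decided by some criterion, which may be arbitrary apart from the conditions stated in the theorem): (a) update $\mu$: $\mu^{k+1}=\mu^k/\omega$ and $\lambda^{k+1}=\lambda^k$; or (b) update $\lambda$: $\mu^{k+1}=\mu^k$ and $\lambda^{k+1}=\mu^k r(x^k)$. ''$\lambda$ is updated at least once every $W$ iterations'' means that among any $W$ consecutive iterations at least one performs update (b). *)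

(* Defs.v *)
From mathcomp Require Export all_boot all_order all_algebra.
From mathcomp Require Export boolp classical_sets reals topology normedtype
  sequences.

Export Order.TTheory GRing.Theory Num.Theory numFieldNormedType.Exports.

#[export] Set Implicit Arguments.
#[export] Unset Strict Implicit.
#[export] Unset Printing Implicit Defensive.

Global Open Scope classical_set_scope.
Global Open Scope ring_scope.

Definition dot (R : realType) (d : nat) (u v : 'cV[R]_d) : R :=
  (u^T *m v) ord0 ord0.

Definition nonneg_orthant (R : realType) (n : nat) : set 'cV[R]_n :=
  [set x | forall i, 0 <= x i ord0].

Definition is_argmin (R : realType) (T : Type) (S : set T) (f : T -> R)
    (x : T) : Prop :=
  S x /\ forall y, S y -> f x <= f y.

Definition residual (R : realType) (m n : nat) (A : 'M[R]_(m, n))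
    (b : 'cV[R]_m) (x : 'cV[R]_n) : 'cV[R]_m :=
  A *m x - b.

Definition lp_feasible (R : realType) (m n : nat) (A : 'M[R]_(m, n))
    (b : 'cV[R]_m) : set 'cV[R]_n :=
  [set x | A *m x = b /\ nonneg_orthant x].

Definition lp_solution (R : realType) (m n : nat) (A : 'M[R]_(m, n))
    (b : 'cV[R]_m) (c : 'cV[R]_n) (x : 'cV[R]_n) : Prop :=
  is_argmin (lp_feasible A b) (dot c) x.

Definition idiot_objective (R : realType) (m n : nat) (A : 'M[R]_(m, n))
    (b : 'cV[R]_m) (c : 'cV[R]_n) (mu : R) (lambda : 'cV[R]_m)
    (x : 'cV[R]_n) : R :=
  dot c x + dot lambda (residual A b x)
  + 1 / (2 * mu) * dot (residual A b x) (residual A b x).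

Inductive idiot_update := UpdateMu | UpdateLambda.

(* [upd k] is the update chosen at iteration [k]; iterations start at [k = 1],
   so [x 0] and [upd 0] are unconstrained.  The multiplier update is
   [mu_k r(x_k)], not the augmented Lagrangian one [lambda_k + r(x_k) / mu_k]. *)
Record idiot_run (R : realType) (m n : nat) (A : 'M[R]_(m, n)) (b : 'cV[R]_m)
    (c : 'cV[R]_n) (omega : R) (upd : nat -> idiot_update) (mu : nat -> R)
    (lambda : nat -> 'cV[R]_m) (x : nat -> 'cV[R]_n) : Prop := IdiotRun {
  idiot_omega : 1 < omega;
  idiot_mu0 : 0 < mu 0%N;
  idiot_lambda0 : lambda 0%N = 0;
  idiot_mu1 : mu 1%N = mu 0%N;
  idiot_lambda1 : lambda 1%N = lambda 0%N;
  idiot_x : forall k : nat, (1 <= k)%N ->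
    is_argmin (@nonneg_orthant R n)
      (idiot_objective A b c (mu k) (lambda k)) (x k);
  idiot_step : forall k : nat, (1 <= k)%N ->
    match upd k with
    | UpdateMu => mu k.+1 = mu k / omega /\ lambda k.+1 = lambda k
    | UpdateLambda =>
        mu k.+1 = mu k /\ lambda k.+1 = mu k *: residual A b (x k)
    end }.

Definition lambda_updated_every (upd : nat -> idiot_update) (W : nat) : Prop :=
  forall k : nat, (1 <= k)%N ->
    exists j : nat, (k <= j < k + W)%N /\ upd j = UpdateLambda.

Definition is_limit_point (T : topologicalType) (u : nat -> T) (l : T) : Prop :=
  exists phi : nat -> nat,
    (forall i j : nat, (i < j)%N -> (phi i < phi j)%N) /\
    (fun i => u (phi i)) @ \oo --> l.

(* Main.v *)
(* The first subproblem, in which [lambda_1 = 0], has a minimum [L], so that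
   [c.x >= L - |r(x)|^2 / (2 mu_1)] for all [x >= 0].  This replaces LP duality.
   Comparing [h_k (x_k)] with [h_k] at an optimal solution of value [p] gives,
   once [mu_k <= mu_1 / 2],
     [lambda_k.r_k + |r_k|^2 / (4 mu_k) <= p - L],
   hence [|r_k|^2 <= 8 mu_k (p - L) + 16 mu_k^2 |lambda_k|^2] after completing
   the square.  As [mu_k -> 0], the update [lambda_(k+1) = mu_k r_k] then keeps
   [lambda] bounded, so [r_k -> 0], and
   [c.x_k <= p - lambda_k.r_k - |r_k|^2 / (2 mu_k) <= p + mu_k |lambda_k|^2 / 2]
   tends to at most [p]. *)
Require Import Defs.
From mathcomp Require Import ring lra.

Lemma dotE (R : realType) (d : nat) (u v : 'cV[R]_d) :
  dot u v = \sum_i u i ord0 * v i ord0.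
Proof. by rewrite /dot mxE; apply: eq_bigr => i _; rewrite mxE. Qed.

Lemma dot_sqr_ge0 (R : realType) (d : nat) (u : 'cV[R]_d) : 0 <= dot u u.
Proof. by rewrite dotE; apply: sumr_ge0 => i _; rewrite -expr2 sqr_ge0. Qed.

Lemma dot_sqr_le0 (R : realType) (d : nat) (u : 'cV[R]_d) :
  dot u u <= 0 -> u = 0.
Proof.
move=> u_le0; have : dot u u == 0 by rewrite eq_le u_le0 dot_sqr_ge0.
rewrite dotE psumr_eq0 => [/allP u0|i _]; last by rewrite -expr2 sqr_ge0.
apply/colP => i; rewrite mxE; apply/eqP.
by have := u0 i (mem_index_enum i); rewrite -expr2 sqrf_eq0.
Qed.

Lemma dot0l (R : realType) (d : nat) (u : 'cV[R]_d) : dot 0 u = 0.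
Proof. by rewrite /dot trmx0 mul0mx mxE. Qed.

Lemma dot0r (R : realType) (d : nat) (u : 'cV[R]_d) : dot u 0 = 0.
Proof. by rewrite /dot mulmx0 mxE. Qed.

Lemma dot_sqrZ (R : realType) (d : nat) (a : R) (u : 'cV[R]_d) :
  dot (a *: u) (a *: u) = a ^+ 2 * dot u u.
Proof.
by rewrite !dotE mulr_sumr; apply: eq_bigr => i _; rewrite !mxE; ring.
Qed.

(** The expression expands [|v + t u|^2]. With [u = lambda k] and [v = r(x k)] it completes the
    square: [t = 4 * mu k] serves the residual bound, [t = mu k] the value bound. *)
Lemma dot_sqrDZ_ge0 (R : realType) (d : nat) (t : R) (u v : 'cV[R]_d) :
  0 <= dot v v + 2 * t * dot u v + t ^+ 2 * dot u u.
Proof.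
suff -> : dot v v + 2 * t * dot u v + t ^+ 2 * dot u u
          = dot (v + t *: u) (v + t *: u) by exact: dot_sqr_ge0.
rewrite !dotE !mulr_sumr -!big_split /=.
by apply: eq_bigr => i _; rewrite !mxE; ring.
Qed.

Lemma cvg_dot (R : realType) (T : Type) (F : set_system T) {FF : Filter F}
    (d : nat) (u v : T -> 'cV[R]_d) (u0 v0 : 'cV[R]_d) :
  (forall i, u t i ord0 @[t --> F] --> u0 i ord0) ->
  (forall i, v t i ord0 @[t --> F] --> v0 i ord0) ->
  dot (u t) (v t) @[t --> F] --> dot u0 v0.
Proof.
move=> uu0 vv0; under eq_fun do rewrite dotE.
rewrite dotE; apply: cvg_big => [|i _]; first exact: add_continuous.
exact: cvgM.
Qed.

Lemma cvg_coord (R : realType) (T : Type) (F : set_system T) {FF : Filter F}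
    (d : nat) (u : T -> 'cV[R]_d) (u0 : 'cV[R]_d) (i : 'I_d) :
  u t @[t --> F] --> u0 -> u t i ord0 @[t --> F] --> u0 i ord0.
Proof.
move=> uu0.
exact: (cvg_comp u (fun M : 'cV[R]_d => M i ord0) uu0
  (@coord_continuous _ _ _ i ord0 u0)).
Qed.

Lemma cvg_residual (R : realType) (T : Type) (F : set_system T)
    {FF : Filter F} (m n : nat) (A : 'M[R]_(m, n)) (b : 'cV[R]_m)
    (x : T -> 'cV[R]_n) (x0 : 'cV[R]_n) (i : 'I_m) :
  x t @[t --> F] --> x0 ->
  residual A b (x t) i ord0 @[t --> F] --> residual A b x0 i ord0.
Proof.
move=> xx0.
(* Up to a constant, each entry of the residual is a dot product with a row of [A], so [cvg_dot]
   applies. *)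
have rE y : residual A b y i ord0 = dot (row i A)^T y - b i ord0.
  by rewrite /residual !mxE dotE; congr (_ - _); apply: eq_bigr => j _;
    rewrite !mxE.
under eq_fun do rewrite rE.
rewrite rE; apply: cvgB; last exact: cvg_cst.
apply: cvg_dot => j; first exact: cvg_cst.
exact: cvg_coord.
Qed.

Section IdiotRun.

Variables (R : realType) (m n : nat) (A : 'M[R]_(m, n)) (b : 'cV[R]_m).
Variables (c : 'cV[R]_n) (omega : R) (upd : nat -> idiot_update).
Variables (mu : nat -> R) (lambda : nat -> 'cV[R]_m) (x : nat -> 'cV[R]_n).
Hypothesis run : idiot_run A b c omega upd mu lambda x.

Let res k := residual A b (x k).

Lemma idiot_mu_gt0 (k : nat) : 0 < mu k.
Proof.
elim: k => [|[|k] IH]; first exact: idiot_mu0 run.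
  by rewrite (idiot_mu1 run).
have := idiot_step run (ltn0Sn k); case: (upd k.+1) => -[-> _] //.
by rewrite divr_gt0 // (lt_trans ltr01) // (idiot_omega run).
Qed.

(** At a feasible point the residual vanishes, so [h_k] reduces there to the linear cost; minimality
    of [x k] does the rest. *)
Lemma idiot_descent (xopt : 'cV[R]_n) (k : nat) :
  lp_feasible A b xopt -> (1 <= k)%N ->
  dot c (x k) + dot (lambda k) (res k) + (mu k)^-1 / 2 * dot (res k) (res k)
    <= dot c xopt.
Proof.
move=> [Axb x0] k1; have [_ /(_ _ x0)] := idiot_x run k1.
have r0 : residual A b xopt = 0 by rewrite /residual Axb subrr.
rewrite /idiot_objective r0 !dot0r mulr0 !addr0.
by rewrite div1r invfM [2^-1 * _]mulrC.
Qed.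

Lemma idiot_lower_bound :
  exists L, forall y, nonneg_orthant y ->
    L <= dot c y + (mu 1%N)^-1 / 2 * dot (residual A b y) (residual A b y).
Proof.
exists (idiot_objective A b c (mu 1%N) (lambda 1%N) (x 1%N)) => y y0.
have [_ /(_ _ y0)] := idiot_x run (leqnn 1).
rewrite [X in _ <= X]/idiot_objective (idiot_lambda1 run) (idiot_lambda0 run).
by rewrite dot0l addr0 div1r invfM [2^-1 * _]mulrC.
Qed.

Lemma idiot_residual_bound (xopt : 'cV[R]_n) :
  lp_feasible A b xopt ->
  exists2 G, 0 <= G & forall k, (1 <= k)%N -> mu k <= mu 1%N / 2 ->
    dot (res k) (res k)
      <= 8 * mu k * G + 16 * (mu k) ^+ 2 * dot (lambda k) (lambda k).
Proof.
move=> xF; have [L LP] := idiot_lower_bound.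
(* This gap is nonnegative because the penalty vanishes at [xopt], so [L] bounds its cost from
   below. *)
exists (dot c xopt - L) => [|k k1 muk].
  have [Axb x0] := xF; have := LP _ x0.
  by rewrite /residual Axb subrr dot0r mulr0 addr0 subr_ge0.
have mk := idiot_mu_gt0 k; have m1 := idiot_mu_gt0 1.
have [xk0 _] := idiot_x run k1.
have := LP _ xk0; have := idiot_descent xF k1; rewrite -/(res k).
have := dot_sqrDZ_ge0 (4 * mu k) (lambda k) (res k).
have := dot_sqr_ge0 (res k).
set q := dot (res k) (res k); set lr := dot (lambda k) (res k).
set ll := dot _ (lambda k) => q0 square Hk H1.
(* Since [mu k <= mu 1%N / 2], the penalty in the lower bound absorbs at most half of
   [q / (2 mu_k)]. *)
have mu1V : (mu 1%N)^-1 * q <= (mu k)^-1 / 2 * q.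
  apply: ler_wpM2r => //; rewrite -invfM lef_pV2 ?posrE ?mulr_gt0 //; lra.
have gap : mu k * (4 * lr + (mu k)^-1 * q) <= mu k * (4 * (dot c xopt - L)).
  by rewrite ler_pM2l //; lra.
(* Adding [square] to twice [gap] cancels the term in [lr]. *)
rewrite mulrDr mulVKf ?gt_eqF // in gap; nra.
Qed.

Lemma idiot_lambda_bound (xopt : 'cV[R]_n) :
  lp_feasible A b xopt -> mu @ \oo --> (0 : R) ->
  exists C, \forall k \near \oo,
    dot (lambda k) (lambda k) <= C /\ dot (res k) (res k) <= C * mu k.
Proof.
move=> xF mu0; have [G G0 GP] := idiot_residual_bound xF.
have m1 := idiot_mu_gt0 1.
have /(cvgr_le _ mu0) small1 : 0 < mu 1%N / 2 by rewrite divr_gt0.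
have /(cvgr_le _ mu0) small4 : (0 : R) < 1 / 4 by lra.
have [N _ NP] : \forall k \near \oo,
    [/\ (1 <= k)%N, mu k <= mu 1%N / 2 & mu k <= 1 / 4].
  by near=> k; split; near: k => //; exact: nbhs_infty_ge.
(* Being above [|lambda_N|^2] starts the induction; being above [G] lets the residual bound be
   expressed in [C] alone. *)
pose C := G + dot (lambda N) (lambda N).
have ll0 := dot_sqr_ge0 (lambda N).
have C0 : 0 <= C by rewrite addr_ge0.
have lamC k : (N <= k)%N -> dot (lambda k) (lambda k) <= C.
  elim: k => [|k IH]; first by rewrite leqn0 => /eqP N0; rewrite /C N0; lra.
  rewrite leq_eqVlt => /orP[/eqP <-|]; first by rewrite /C; lra.
  rewrite ltnS => Nk; have {IH} ih := IH Nk.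
  have [k1 muk1 muk4] := NP _ Nk; have := GP _ k1 muk1.
  (* A [mu] update leaves [lambda] fixed. For a [lambda] update, [mu k <= 1 / 4] gives
     [|r_k|^2 <= 2C + C], hence [|lambda_(k+1)|^2 = mu_k^2 |r_k|^2 <= 3C / 16]. *)
  have := idiot_step run k1; case: (upd k) => -[_ ->] // resk.
  rewrite dot_sqrZ -/(res k).
  have mk := idiot_mu_gt0 k.
  have GC : G <= C by rewrite /C; lra.
  have lk := dot_sqr_ge0 (lambda k).
  have q0 := dot_sqr_ge0 (res k).
  have mu2 : (mu k) ^+ 2 <= 1 / 16 by nra.
  have muG : mu k * G <= 1 / 4 * C by apply: ler_pM => //; exact: ltW.
  have mul : (mu k) ^+ 2 * dot (lambda k) (lambda k) <= 1 / 16 * C.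
    by apply: ler_pM => //; exact: sqr_ge0.
  have qC : dot (res k) (res k) <= 3 * C by lra.
  have : (mu k) ^+ 2 * dot (res k) (res k) <= 1 / 16 * (3 * C).
    by apply: ler_pM => //; exact: sqr_ge0.
  lra.
(* As [mu k <= 1 / 4], the residual bound is at most [8 mu_k C + 16 mu_k (C / 4) = 12 C mu_k]. *)
exists (12 * C).
near=> k.
have Nk : (N <= k)%N by near: k; exact: nbhs_infty_ge.
have lk := lamC _ Nk; have [k1 muk1 muk4] := NP _ Nk; split; first lra.
have := GP _ k1 muk1; have mk := idiot_mu_gt0 k.
have muG : mu k * G <= mu k * C by rewrite ler_pM2l // /C; lra.
have mul : mu k * (mu k * dot (lambda k) (lambda k)) <= mu k * (1 / 4 * C).
  by rewrite ler_pM2l //; apply: ler_pM => //; [exact: ltW|exact: dot_sqr_ge0].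
rewrite expr2; lra.
Unshelve. all: by end_near.
Qed.

Lemma idiot_value_bound (xopt : 'cV[R]_n) (k : nat) :
  lp_feasible A b xopt -> (1 <= k)%N ->
  dot c (x k) <= dot c xopt + mu k / 2 * dot (lambda k) (lambda k).
Proof.
move=> xF k1; have := idiot_descent xF k1.
have mk := idiot_mu_gt0 k; have := dot_sqrDZ_ge0 (mu k) (lambda k) (res k).
set q := dot (res k) _; set lr := dot _ (res k); set ll := dot _ (lambda k).
(* Dividing [|r_k + mu_k lambda_k|^2 >= 0] by [2 mu_k] bounds [lr + q / (2 mu_k)] below by
   [- mu_k ll / 2]. *)
rewrite -(pmulr_rge0 _ (_ : 0 < (mu k)^-1)) ?invr_gt0 //.
have -> : (mu k)^-1 * (q + 2 * mu k * lr + mu k ^+ 2 * ll)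
          = (mu k)^-1 * q + 2 * lr + mu k * ll by field; rewrite gt_eqF.
lra.
Qed.

End IdiotRun.

Theorem theorem1 (R : realType) (m n : nat) (A : 'M[R]_(m, n))
    (b : 'cV[R]_m) (c : 'cV[R]_n)
    (omega : R) (upd : nat -> idiot_update) (mu : nat -> R)
    (lambda : nat -> 'cV[R]_m) (x : nat -> 'cV[R]_n) (W : nat)
    (hmn : (m < n)%N) (hA : \rank A = m)
    (hopt : exists xopt : 'cV[R]_n, lp_solution A b c xopt)
    (hrun : idiot_run A b c omega upd mu lambda x)
    (hW : lambda_updated_every upd W)
    (hmu : mu @ \oo --> (0 : R)) :
  forall xbar : 'cV[R]_n,
    is_limit_point (fun k : nat => x k.+1) xbar -> lp_solution A b c xbar.
Proof.
move=> xbar [phi [phi_incr xphi]].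
have [xopt [xF xopt_min]] := hopt.
have [C HC] := idiot_lambda_bound hrun xF hmu.
(* Hence the shifted indices tend to infinity, and eventual bounds pass to the subsequence. *)
have phi_ge i : (i <= phi i)%N.
  by elim: i => // i IH; exact: leq_ltn_trans IH (phi_incr _ _ (ltnSn i)).
have phi_oo : (phi i).+1 @[i --> \oo] --> \oo.
  apply/cvgnyPge => N; near=> i; apply: leqW; apply: leq_trans (phi_ge i).
  by near: i; exact: nbhs_infty_ge.
have mu_phi : mu (phi i).+1 @[i --> \oo] --> (0 : R).
  exact: cvg_comp phi_oo hmu.
have near_phi : \forall i \near \oo, let k := (phi i).+1 in
    dot (lambda k) (lambda k) <= C
    /\ dot (residual A b (x k)) (residual A b (x k)) <= C * mu k.
  exact: phi_oo HC.
have res0 : residual A b xbar = 0.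
  (* Zero is written as [C * 0], the limit of the bounds [C * mu k] on the squared residuals. *)
  apply: dot_sqr_le0; rewrite -(mulr0 C).
  have cvg_res i : residual A b (x (phi k).+1) i ord0 @[k --> \oo]
      --> residual A b xbar i ord0 by exact: cvg_residual xphi.
  apply: ler_cvg_to (cvg_dot cvg_res cvg_res) (cvgM (cvg_cst C) mu_phi) _.
  by apply: filterS near_phi => i [].
have cvg_x j : x (phi i).+1 j ord0 @[i --> \oo] --> xbar j ord0.
  exact: (cvg_coord xphi).
have xbar0 : nonneg_orthant xbar.
  move=> j; apply: cvgr_to_ge (cvg_x j) _.
  by near=> i; have [] := idiot_x hrun (ltn0Sn (phi i)).
split; first by split=> //; apply/eqP; rewrite -subr_eq0; apply/eqP.
move=> y /xopt_min; apply: le_trans.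
(* The optimal value is put in the form of the limit of the bounds [dot c xopt + mu k / 2 * C]. *)
have -> : dot c xopt = dot c xopt + 0 / 2 * C by rewrite !mul0r addr0.
apply: ler_cvg_to (cvg_dot (fun j => cvg_cst (c j ord0)) cvg_x)
  (cvgD (cvg_cst _) (cvgM (cvgM mu_phi (cvg_cst _)) (cvg_cst C))) _.
apply: filterS near_phi => i [lC _].
apply: le_trans (idiot_value_bound hrun xF (ltn0Sn _)) _.
rewrite lerD2l; apply: ler_wpM2l => //.
by rewrite divr_ge0 // ltW // (idiot_mu_gt0 hrun).
Unshelve. all: by end_near.
Qed.
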